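(* Let $n\ge 1$, $s_{\mathcal L}\in\mathbb C^n$, $V_0\ge 0$, $\theta_0\in(-\pi,\pi]$, and let $Z\in\mathbb C^{n\times n}$ be the impedance matrix of the grid, $Z=Y_{\mathcal L\mathcal L}^{-1}$. If $$V_0^2 > 4\,\|Z\|^*\,\|s_{\mathcal L}\|,$$ then there exists a unique solution $v_{\mathcal L}\in\mathbb C^n$ of the power flow equations of the form $$v_{\mathcal L}=V_0e^{j\theta_0}\left(\mathbf 1+\frac{1}{V_0^2}Z\bar s_{\mathcal L}+\frac{1}{V_0^4}Z\lambda\right),$$ where $\lambda\in\mathbb C^n$ is such that $$\|\lambda\|\le 4\,\|Z\|^*\,\|s_{\mathcal L}\|^2 .$$ That is, there is exactly one $v_{\mathcal L}\in\mathbb C^n$ that is a solution of the power flow equations and can be written in the displayed form for some $\lambda\in\mathbb C^n$ satisfying this bound.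
   Context: Here $j$ is the imaginary unit, a bar denotes entrywise complex conjugation, $\mathbf 1$ is the all-ones vector, and $\operatorname{diag}(x)$ is the diagonal matrix with the entries of the vector $x$ on the diagonal. Grid: the buses are $\{0,1,\dots,n\}$, with $\mathcal L=\{1,\dots,n\}$. The nodal admittance matrix $Y\in\mathbb C^{(n+1)\times(n+1)}$ is the weighted Laplacian of the connected graph describing the grid (complex edge weights equal to the line admittances), so $Y\mathbf 1=0$. The block $Y_{\mathcal L\mathcal L}\in\mathbb C^{n\times n}$, obtained by deleting the row and column of bus $0$, is invertible, and $Z:=Y_{\mathcal L\mathcal L}^{-1}$. Power flow equations: given $V_0$, $\theta_0$, $s_{\mathcal L}$, a vector $v_{\mathcal L}\in\mathbb C^n$ is a solution of the power flow equations if there exists $i_{\mathcal L}\in\mathbb C^n$ such that, with $v_0=V_0e^{j\theta_0}$, $$s_{\mathcal L}=\operatorname{diag}(\bar i_{\mathcal L})\,v_{\mathcal L},\qquad v_{\mathcal L}=v_0\mathbf 1+Z\,i_{\mathcal L}.$$ Norms: for $x\in\mathbb C^n$, $\|x\|=\sqrt{\sum_h|x_h|^2}$; for $A\in\mathbb C^{n\times n}$, $\|A\|^*=\max_h\sqrt{\sum_k|A_{hk}|^2}$ (the maximum of the 2-norms of the rows of $A$). *)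

(* Defs.v *)
From HB Require Import structures.
From mathcomp Require Import all_boot all_order all_algebra.
From mathcomp Require Import complex.
From mathcomp Require Import all_classical all_reals all_analysis.

Set Implicit Arguments.
Unset Strict Implicit.
Unset Printing Implicit Defensive.

Import Order.TTheory GRing.Theory Num.Theory.
Local Open Scope ring_scope.

(* The reference bus 0 is [ord0]. [admittance_matrix] reads [admittance] on
   lines only, so its values on the other pairs are irrelevant. *)
Record grid (R : realType) (n : nat) := Grid {
  line : rel 'I_n.+1;
  admittance : 'I_n.+1 -> 'I_n.+1 -> R[i];
  line_sym : symmetric line;
  line_irr : irreflexive line;
  admittance_sym : forall h k, admittance h k = admittance k h;
  grid_connected : forall h k, connect line h k
}.

Section PowerFlow.
Variables (R : realType) (n : nat).
Implicit Types (G : grid R n) (x s v : 'cV[R[i]]_n) (Z : 'M[R[i]]_n).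

Definition admittance_matrix G : 'M[R[i]]_n.+1 :=
  \matrix_(h, k)
    (if h == k then \sum_(l | line G h l) admittance G h l
     else if line G h k then - admittance G h k else 0).

Definition load_admittance_matrix G : 'M[R[i]]_n :=
  row' ord0 (col' ord0 (admittance_matrix G)).

Definition expj (t : R) : R[i] := Complex (cos t) (sin t).

Definition conjv x : 'cV[R[i]]_n := map_mx Num.conj x.

(* [normc] is the modulus with values in [R]; the norm [`|_|] of [R[i]] takes
   its values in [R[i]]. *)
Definition vnorm x : R :=
  Num.sqrt (\sum_h ComplexField.Normc.normc (x h 0) ^+ 2).

(* The default value 0 is harmless for [0 < n]: the row norms are nonnegative. *)
Definition mnorm Z : R :=
  \big[Num.max/0]_h
     Num.sqrt (\sum_k ComplexField.Normc.normc (Z h k) ^+ 2).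

Definition power_flow_solution Z (V0 theta0 : R) s v : Prop :=
  let v0 := real_complex R V0 * expj theta0 in
  exists i : 'cV[R[i]]_n,
    s = diag_mx (conjv i)^T *m v /\ v = v0 *: const_mx 1 + Z *m i.

End PowerFlow.

(* Main.v *)
(* Put v = V0 e^{j theta0} (1 + y).  The power flow equations say that y is a
   fixed point of y |-> V0^-2 Z (conj s / conj (1 + y)).  Cauchy-Schwarz on the
   rows of Z gives |(Z x)_h| <= ||Z||^* ||x||, so with
   q = ||Z||^* ||s|| / V0^2 < 1/4 this map sends the ball |y|_oo <= 1/2 into the
   ball of radius 2q and is 4q-Lipschitz there for the sup norm.  Banach's
   principle yields exactly one solution with |y|_oo <= 1/2.  It satisfies
   |y|_oo <= 2q, hence lambda = V0^2 (conj s / conj (1 + y) - conj s) has norm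
   at most V0^2 4q ||s||; conversely the bound on lambda forces
   |y|_oo <= q + 4q^2 <= 1/2. *)
Require Import Defs.
From HB Require Import structures.
From mathcomp Require Import all_boot all_order all_algebra.
From mathcomp Require Import complex.
From mathcomp Require Import all_classical all_reals all_analysis.
From mathcomp Require Import ring lra.

Set Implicit Arguments.
Unset Strict Implicit.
Unset Printing Implicit Defensive.

Import Order.TTheory GRing.Theory Num.Theory.
Import numFieldNormedType.Exports.
Local Open Scope classical_set_scope.
Local Open Scope ring_scope.

Local Notation normc := ComplexField.Normc.normc.

(** * The modulus of complex numbers as a real number *)

Section Modulus.
Variable R : realType.
Implicit Types x y : R[i].

Lemma normc_ge0 x : 0 <= normc x.
Proof. by case: x => a b; exact: sqrtr_ge0. Qed.

Lemma normcM x y : normc (x * y) = normc x * normc y.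
Proof. exact: ComplexField.Normc.normcM. Qed.

Lemma normcV x : normc x^-1 = (normc x)^-1.
Proof. exact: ComplexField.Normc.normcV. Qed.

Lemma normcX x k : normc (x ^+ k) = normc x ^+ k.
Proof.
elim: k => [|k IH]; first exact: ComplexField.Normc.normc1.
by rewrite !exprS normcM IH.
Qed.

Lemma normc_opp x : normc (- x) = normc x.
Proof. exact: normcN. Qed.

Lemma ler_normcD x y : normc (x + y) <= normc x + normc y.
Proof. exact: le_normcD. Qed.

Lemma ler_normcB x y : normc (x - y) <= normc x + normc y.
Proof. by rewrite -(normc_opp y) ler_normcD. Qed.

Lemma normc_real (a : R) : 0 <= a -> normc (real_complex R a) = a.
Proof. by move=> a0; rewrite /= expr0n /= addr0 sqrtr_sqr ger0_norm. Qed.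

Lemma normc_conj x : normc (Num.conj x) = normc x.
Proof.
have : `|Num.conj x| = `|x| by rewrite norm_conjC.
by move=> [].
Qed.

(** The sharp constant is sqrt 2; the looser 2 suffices because it only enters geometric error
    bounds. *)
Lemma normc_Re_Im x (d : R) :
  `|complex.Re x| <= d -> `|complex.Im x| <= d -> normc x <= 2 * d.
Proof.
case: x => a b /= had hbd.
have d0 : 0 <= d := le_trans (normr_ge0 _) had.
rewrite -(@ger0_norm _ (2 * d)) ?mulr_ge0 // -sqrtr_sqr ler_wsqrtr //.
have := lerXn2r 2 (normr_ge0 a) d0 had; have := lerXn2r 2 (normr_ge0 b) d0 hbd.
by rewrite !real_normK ?num_real //; have := sqr_ge0 d; lra.
Qed.

Lemma Re_le_normc x : `|complex.Re x| <= normc x.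
Proof.
case: x => a b /=; rewrite -sqrtr_sqr ler_wsqrtr //; have := sqr_ge0 b; lra.
Qed.

Lemma Im_le_normc x : `|complex.Im x| <= normc x.
Proof.
case: x => a b /=; rewrite -sqrtr_sqr ler_wsqrtr //; have := sqr_ge0 a; lra.
Qed.

(** Reverse triangle inequality: for [r < 1] it keeps the denominators [1 + y] away from 0. *)
Lemma normc_1D_ge y (r : R) : normc y <= r -> 1 - r <= normc (1 + y).
Proof.
move=> hy; have := ler_normcB (1 + y) y.
rewrite addrK ComplexField.Normc.normc1; lra.
Qed.

Lemma add1_neq0 y (r : R) : r < 1 -> normc y <= r -> 1 + y != 0.
Proof.
move=> r1 /normc_1D_ge; apply: contraTneq => ->.
by rewrite ComplexField.Normc.normc0; lra.
Qed.

End Modulus.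

(** * Cauchy-Schwarz and estimates for the two norms *)

Section Norms.
Variables (R : realType) (n : nat).
Implicit Types (x s : 'cV[R[i]]_n) (Z : 'M[R[i]]_n).

(** Summing the squares [(Q * a k - S * b k) ^+ 2] gives [Q * (Q * P - S ^+ 2)], which is therefore
    nonnegative. Either [Q] can be cancelled or every [b k] vanishes. *)
Lemma cauchy_schwarz (a b : 'I_n -> R) :
  \sum_k a k * b k <= Num.sqrt (\sum_k a k ^+ 2) * Num.sqrt (\sum_k b k ^+ 2).
Proof.
set P := \sum_k a k ^+ 2; set Q := \sum_k b k ^+ 2; set S := \sum_k a k * b k.
have P0 : 0 <= P by apply: sumr_ge0 => k _; exact: sqr_ge0.
have Q0 : 0 <= Q by apply: sumr_ge0 => k _; exact: sqr_ge0.
rewrite -sqrtrM //; apply: (le_trans (ler_norm S)).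
rewrite -sqrtr_sqr ler_wsqrtr //.
have key : 0 <= Q * (Q * P - S ^+ 2).
  have -> : Q * (Q * P - S ^+ 2) = \sum_k (Q * a k - S * b k) ^+ 2.
    under eq_bigr => k _.
      have -> : (Q * a k - S * b k) ^+ 2 =
        Q ^+ 2 * a k ^+ 2 - 2 * Q * S * (a k * b k) + S ^+ 2 * b k ^+ 2 by ring.
      over.
    by rewrite big_split /= sumrB -!mulr_sumr -/P -/Q -/S; ring.
  by apply: sumr_ge0 => k _; exact: sqr_ge0.
have [Qp|] := ltP 0 Q; first by move: key; rewrite pmulr_rge0 //; lra.
move=> Qle0; have Qz : Q = 0 by apply/eqP; rewrite eq_le Qle0.
have bz k : b k = 0.
  apply/eqP; rewrite -sqrf_eq0; apply/eqP.
  by apply: (psumr_eq0P _ Qz) => // j _; exact: sqr_ge0.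
have -> : S = 0 by apply: big1 => k _; rewrite bz mulr0.
by rewrite expr0n /= mulr_ge0.
Qed.

Lemma normc_sum (I : finType) (F : I -> R[i]) :
  normc (\sum_k F k) <= \sum_k normc (F k).
Proof.
elim/big_ind2: _ => [|x1 x2 y1 y2 h1 h2|//].
  by rewrite ComplexField.Normc.normc0.
exact: le_trans (ler_normcD _ _) (lerD h1 h2).
Qed.

Lemma vnorm_ge0 x : 0 <= vnorm x.
Proof. exact: sqrtr_ge0. Qed.

Lemma mnorm_ge0 Z : 0 <= mnorm Z.
Proof. by rewrite /mnorm; apply: bigmax_ge_id. Qed.

Lemma normc_mulmx Z x h : normc ((Z *m x) h 0) <= mnorm Z * vnorm x.
Proof.
rewrite mxE; apply: (le_trans (normc_sum _)).
under eq_bigr do rewrite normcM.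
apply: (le_trans (cauchy_schwarz _ _)).
apply: ler_wpM2r; first exact: sqrtr_ge0.
exact: (le_bigmax 0
  (fun h => Num.sqrt (\sum_k normc (Z h k) ^+ 2))).
Qed.

(** Carries a sup-norm bound on an entrywise factor, such as 1 / (1 + y), over to the Euclidean norm
    of the product. *)
Lemma ler_vnorm s x (c : R) : 0 <= c ->
  (forall h, normc (x h 0) <= c * normc (s h 0)) -> vnorm x <= c * vnorm s.
Proof.
move=> c0 hx; rewrite /vnorm -{1}(ger0_norm c0) -sqrtr_sqr -sqrtrM ?sqr_ge0 //.
apply: ler_wsqrtr; rewrite mulr_sumr; apply: ler_sum => h _.
by rewrite -exprMn; apply: lerXn2r (hx h); rewrite nnegrE ?mulr_ge0 ?normc_ge0.
Qed.

End Norms.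

(** * Sequences with geometric error bounds *)

Section FixedPoint.
Variable R : realType.

Lemma geometric_archi (C r e : R) : 0 <= r < 1 -> 0 < e ->
  exists k, C * r ^+ k < e.
Proof.
move=> /andP[r0 r1] e0.
have cv : (fun k => C * r ^+ k) @ \oo --> (C * 0 : R).
  by apply: cvgMl_tmp; apply: cvg_expr; rewrite ger0_norm.
rewrite mulr0 in cv.
have /cvgr_lt/(_ e e0) [N _ hN] := cv.
by exists N; apply: (hN N) => /=.
Qed.

(** Does the work of a passage to the limit in the fixed-point arguments, where each inequality
    holds up to an error [C * r ^+ k] for every [k]. *)
Lemma le_geometric (a b C r : R) : 0 <= r < 1 ->
  (forall k, a <= b + C * r ^+ k) -> a <= b.
Proof.
move=> hr hab; rewrite leNgt; apply/negP => ba.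
have [k hk] := @geometric_archi C r (a - b) hr ltac:(lra).
have := hab k; lra.
Qed.

(* [u k - C r^k] increases and [u k + C r^k] decreases, so they are adjacent. *)
Lemma geometric_cauchy_real (u : nat -> R) (C r : R) : 0 <= r < 1 -> 0 <= C ->
  (forall k, `|u k.+1 - u k| <= C * (1 - r) * r ^+ k) ->
  exists l, forall k, `|u k - l| <= C * r ^+ k.
Proof.
move=> /andP[r0 r1] C0 hu.
pose lo k := u k - C * r ^+ k; pose up k := u k + C * r ^+ k.
have lo1 k : lo k <= lo k.+1.
  by have := hu k; rewrite ler_norml /lo exprS => /andP[]; lra.
have up1 k : up k.+1 <= up k.
  by have := hu k; rewrite ler_norml /up exprS => /andP[]; lra.
have lom : {homo lo : i j / (i <= j)%N >-> i <= j}.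
  exact: homo_leq le_refl le_trans lo1.
have upm : {homo up : i j / (i <= j)%N >-> j <= i}.
  apply: (@homo_leq _ up (fun a b => b <= a)) => // y x z yx zy.
  exact: le_trans zy yx.
(* By monotonicity both sides can be moved to the common index [maxn i j], where they differ by
   twice the error term. *)
have loup i j : lo i <= up j.
  have h : lo (maxn i j) <= up (maxn i j).
    by have := mulr_ge0 C0 (exprn_ge0 (maxn i j) r0); rewrite /lo /up; lra.
  apply: le_trans (lom _ _ (leq_maxl i j)) _.
  exact: le_trans h (upm _ _ (leq_maxr i j)).
exists (sup (range lo)) => k.
have h1 : lo k <= sup (range lo).
  apply: ub_le_sup; last by exists k.
  by exists (up 0%N) => _ [i _ <-].
have h2 : sup (range lo) <= up k.
  apply: ge_sup; first by exists (lo 0%N); exists 0%N.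
  by move=> _ [i _ <-].
by move: h1 h2; rewrite /lo /up ler_norml => *; apply/andP; split; lra.
Qed.

(** Real and imaginary parts converge separately; recombining them costs the factor 2. *)
Lemma geometric_cauchy (u : nat -> R[i]) (C r : R) : 0 <= r < 1 -> 0 <= C ->
  (forall k, normc (u k.+1 - u k) <= C * (1 - r) * r ^+ k) ->
  exists l, forall k, normc (u k - l) <= 2 * (C * r ^+ k).
Proof.
move=> hr C0 hu.
have [a ha] : exists l, forall k, `|complex.Re (u k) - l| <= C * r ^+ k.
  apply: geometric_cauchy_real => // k; rewrite -raddfB.
  exact: le_trans (Re_le_normc _) (hu k).
have [b hb] : exists l, forall k, `|complex.Im (u k) - l| <= C * r ^+ k.
  apply: geometric_cauchy_real => // k; rewrite -raddfB.
  exact: le_trans (Im_le_normc _) (hu k).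
exists (Complex a b) => k; apply: normc_Re_Im; rewrite raddfB.
- exact: ha.
- exact: hb.
Qed.

(** * Banach's principle for the sup norm, with balls written entrywise *)

Section Contraction.
Variables (n : nat) (F : 'cV[R[i]]_n -> 'cV[R[i]]_n) (rho r : R).
Let bounded (x : 'cV[R[i]]_n) d := forall h, normc (x h 0) <= d.
Hypotheses (r01 : 0 <= r < 1) (rho0 : 0 <= rho).
Hypothesis F_ball : forall x, bounded x rho -> bounded (F x) rho.
Hypothesis F_lip : forall x y d,
  bounded x rho -> bounded y rho -> bounded (x - y) d ->
  bounded (F x - F y) (r * d).

(** Between fixed points, any distance bound [d] improves to [r * d]; iterating from [2 * rho]
    forces distance 0. *)
Lemma contraction_unique x y : bounded x rho -> bounded y rho ->
  F x = x -> F y = y -> x = y.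
Proof.
move=> bx hy Fx Fy.
have dist k : bounded (x - y) (2 * rho * r ^+ k).
  elim: k => [|k IH].
    move=> h; rewrite !mxE; apply: (le_trans (ler_normcB _ _)).
    by have := bx h; have := hy h; rewrite expr0; lra.
  by have := F_lip bx hy IH; rewrite Fx Fy mulrCA exprS.
apply/matrixP => h j; rewrite ord1; apply/eqP; rewrite -subr_eq0; apply/eqP.
apply: ComplexField.Normc.eq0_normc; apply/eqP.
rewrite eq_le normc_ge0 andbT; apply: (@le_geometric _ _ (2 * rho) r r01) => k.
by have := dist k h; rewrite add0r !mxE.
Qed.

(** Picard iteration from 0, whose limit is built entry by entry. *)
Lemma contraction_exists : exists2 x, bounded x rho & F x = x.
Proof.
pose u k := iter k F 0.
have bu k : bounded (u k) rho.
  elim: k => [h|k IH]; first by rewrite mxE ComplexField.Normc.normc0.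
  exact: F_ball.
have du k : bounded (u k.+1 - u k) (rho * r ^+ k).
  elim: k => [|k IH]; first by rewrite expr0 mulr1 /= subr0; exact: (bu 1%N).
  by have := F_lip (bu k.+1) (bu k) IH; rewrite mulrCA exprS.
case/andP: (r01) => r0 r1.
have r1' : 0 < 1 - r by lra.
(* Chosen so that [C * (1 - r) = rho], the form of step bound that [geometric_cauchy] takes. *)
pose C := rho / (1 - r).
have C0 : 0 <= C by rewrite divr_ge0 // ltW.
have /choice [l hl] : forall h, exists l, forall k,
    normc (u k h 0 - l) <= 2 * (C * r ^+ k).
  move=> h; apply: geometric_cauchy => // k; rewrite divfK ?gt_eqF //.
  by have := du k h; rewrite !mxE.
pose x : 'cV[R[i]]_n := \col_h l h.
have ux k : bounded (u k - x) (2 * (C * r ^+ k)).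
  by move=> h; have := hl h k; rewrite !mxE.
have bx : bounded x rho.
  move=> h; apply: (@le_geometric _ _ (2 * C) r r01) => k.
  have := ler_normcB (u k h 0) ((u k - x) h 0).
  rewrite {1}[(u k - x) h 0]mxE [(- x) h 0]mxE opprB addrC subrK.
  by have := bu k h; have := ux k h; lra.
exists x => //.
apply/matrixP => h j; rewrite ord1; apply/eqP; rewrite -subr_eq0; apply/eqP.
apply: ComplexField.Normc.eq0_normc; apply/eqP.
rewrite eq_le normc_ge0 andbT.
(* The defect of [x] splits at the iterate [u k.+1 = F (u k)] into two terms, each at most
   [2 * C * r ^+ k.+1]. *)
apply: (@le_geometric _ _ (4 * C * r) r r01) => k.
have -> : F x h 0 - x h 0 = (u k.+1 - x) h 0 - (F (u k) - F x) h 0.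
  by rewrite !mxE /= opprB addrC addrA subrK.
apply: (le_trans (ler_normcB _ _)).
have := F_lip (bu k) bx (ux k) h; have := ux k.+1 h; rewrite exprS; lra.
Qed.

End Contraction.
End FixedPoint.

(** * The fixed-point map on sup-norm balls *)

Section LoadMap.
Variables (R : realType) (n : nat) (Z : 'M[R[i]]_n) (s : 'cV[R[i]]_n).
Variable t : R[i].
Implicit Types y : 'cV[R[i]]_n.
Let q := normc t * mnorm Z * vnorm s.

(** For v = v0 (1 + y), this is the physical current conj (s / v) rescaled by conj v0, which makes
    it independent of v0. *)
Definition load_current y : 'cV[R[i]]_n :=
  \col_h Num.conj (s h 0 / (1 + y h 0)).

Definition load_map y : 'cV[R[i]]_n := t *: (Z *m load_current y).

Lemma normc_inv_1D (z : R[i]) (r : R) :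
  r < 1 -> normc z <= r -> normc (1 + z)^-1 <= (1 - r)^-1.
Proof.
move=> r1 hz; have h := normc_1D_ge hz.
by rewrite normcV lef_pV2 // posrE; lra.
Qed.

Lemma load_map_bound y (r : R) h : r < 1 ->
  (forall k, normc (y k 0) <= r) ->
  normc (load_map y h 0) <= q / (1 - r).
Proof.
move=> r1 hy; rewrite mxE normcM /q -!mulrA ler_wpM2l ?normc_ge0 //.
apply: (le_trans (normc_mulmx _ _ _)); rewrite ler_wpM2l ?mnorm_ge0 //.
rewrite mulrC; apply: ler_vnorm => [|k]; first by rewrite invr_ge0; lra.
rewrite mxE normc_conj normcM mulrC ler_wpM2r ?normc_ge0 //.
exact: normc_inv_1D.
Qed.

(** The difference of the inverses of [1 + y] and [1 + y'] is [y' - y] over both denominators,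
    whence the square of [1 - r]. *)
Lemma load_map_lipschitz y y' (r d : R) h : r < 1 ->
  (forall k, normc (y k 0) <= r) -> (forall k, normc (y' k 0) <= r) ->
  (forall k, normc ((y - y') k 0) <= d) ->
  normc ((load_map y - load_map y') h 0) <= q / (1 - r) ^+ 2 * d.
Proof.
move=> r1 hy hy' hd.
have d0 : 0 <= d := le_trans (normc_ge0 _) (hd h).
rewrite -scalerBr -mulmxBr mxE normcM /q -!mulrA ler_wpM2l ?normc_ge0 //.
apply: (le_trans (normc_mulmx _ _ _)); rewrite ler_wpM2l ?mnorm_ge0 //.
rewrite mulrC; apply: ler_vnorm => [|k].
  by rewrite mulr_ge0 // invr_ge0 exprn_ge0 //; lra.
have -> : (load_current y - load_current y') k 0 =
    Num.conj ((1 + y k 0)^-1 * (1 + y' k 0)^-1 * - ((y - y') k 0) * s k 0).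
  rewrite !mxE -rmorphB; congr Num.conj.
  have := add1_neq0 r1 (hy k); have := add1_neq0 r1 (hy' k) => ? ?.
  by field; apply/andP.
rewrite normc_conj normcM ler_wpM2r ?normc_ge0 // !normcM normc_opp.
rewrite expr2 invfM; apply: ler_pM => //; rewrite ?mulr_ge0 ?normc_ge0 //.
by apply: ler_pM; rewrite ?normc_ge0 // normc_inv_1D.
Qed.

(* [e] is the sharper bound 2q on the fixed point, [r] = 1/2 the crude one: the
   denominator then gives the constant 4 exactly. *)
Lemma load_current_sub y (r e : R) : r < 1 ->
  (forall k, normc (y k 0) <= r) -> (forall k, normc (y k 0) <= e) ->
  0 <= e -> vnorm (load_current y - conjv s) <= e / (1 - r) * vnorm s.
Proof.
move=> r1 hy he e0; apply: ler_vnorm => [|k].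
  by rewrite divr_ge0 //; lra.
have -> : (load_current y - conjv s) k 0 =
    Num.conj (- y k 0 * (1 + y k 0)^-1 * s k 0).
  rewrite !mxE -rmorphB; congr Num.conj.
  by have := add1_neq0 r1 (hy k) => ?; field.
rewrite normc_conj normcM ler_wpM2r ?normc_ge0 // normcM normc_opp.
by apply: ler_pM; rewrite ?normc_ge0 // normc_inv_1D.
Qed.

End LoadMap.

(** * From the power flow equations to the fixed-point equation *)

Lemma normc_expj (R : realType) (t : R) : normc (expj t) = 1.
Proof. by rewrite /= cos2Dsin2 sqrtr1. Qed.

Lemma mulr_conj_normc (R : realType) (x : R[i]) :
  x * Num.conj x = real_complex R (normc x) ^+ 2.
Proof. by rewrite -normCK. Qed.

(** Since v0 conj v0 = V0^2, one factor normalises the voltage and the other the current, so the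
    phase [theta0] drops out. *)
Lemma power_flow_solutionP (R : realType) (n : nat) (Z : 'M[R[i]]_n)
    (V0 theta0 : R) (s y : 'cV[R[i]]_n) :
  0 < V0 -> (forall h, 1 + y h 0 != 0) ->
  power_flow_solution Z V0 theta0 s
    ((real_complex R V0 * expj theta0) *: (const_mx 1 + y)) <->
  load_map Z s (real_complex R V0 ^- 2) y = y.
Proof.
move=> V00 y1; rewrite /power_flow_solution; set v0 := _ * expj _.
have nv0 : normc v0 = V0 by rewrite normcM normc_expj mulr1 normc_real ?ltW.
have v0n : v0 != 0.
  by apply/eqP => h; move: nv0; rewrite h ComplexField.Normc.normc0; lra.
have cv0n : Num.conj v0 != 0 by rewrite conjC_eq0.
have vv : real_complex R V0 ^- 2 = v0^-1 * (Num.conj v0)^-1.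
  by rewrite -invfM mulr_conj_normc nv0.
rewrite vv /load_map; clearbody v0; split=> [[i [hs hv]]|hy].
- have hZi : Z *m i = v0 *: y.
    by apply: (addrI (v0 *: const_mx 1)); rewrite -hv scalerDr.
  have -> : load_current s y = Num.conj v0 *: i.
    apply/matrixP => h j; rewrite ord1 !mxE hs mul_diag_mx !mxE.
    by rewrite mulrA mulfK // rmorphM /= conjCK mulrC.
  by rewrite -scalemxAr hZi !scalerA mulfVK // mulVf // scale1r.
(* This current is conj (s / v), as the power equation dictates. *)
- exists ((Num.conj v0)^-1 *: load_current s y); split.
    apply/matrixP => h j; rewrite ord1 mul_diag_mx !mxE.
    rewrite !(rmorphM, fmorphV) /= !conjCK.
    by have := y1 h => ?; field; apply/andP.
  rewrite scalerDr; congr (_ + _); rewrite -{1}hy -scalemxAr scalerA.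
  by rewrite mulrA mulfV // mul1r.
Qed.

Theorem theorem1 (R : realType) (n : nat) (hn : (1 <= n)%N)
  (G : grid R n) (Z : 'M[R[i]]_n)
  (hY : load_admittance_matrix G \in unitmx)
  (hZ : Z = invmx (load_admittance_matrix G))
  (s : 'cV[R[i]]_n) (V0 theta0 : R)
  (hV0 : 0 <= V0) (htheta0 : - pi < theta0 <= pi)
  (hV : V0 ^+ 2 > 4 * mnorm Z * vnorm s) :
  exists! v : 'cV[R[i]]_n,
    power_flow_solution Z V0 theta0 s v /\
    exists lambda : 'cV[R[i]]_n,
      v = (real_complex R V0 * expj theta0) *:
            (const_mx 1 + real_complex R V0 ^- 2 *: (Z *m conjv s)
                        + real_complex R V0 ^- 4 *: (Z *m lambda)) /\
      vnorm lambda <= 4 * mnorm Z * vnorm s ^+ 2.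
Proof.
have A0 := mnorm_ge0 Z; have S0 := vnorm_ge0 s.
have V2 : 0 < V0 ^+ 2 by apply: le_lt_trans hV; rewrite !mulr_ge0.
have V00 : 0 < V0.
  by rewrite lt_neqAle hV0 andbT; move: V2; rewrite exprn_even_gt0 //= eq_sym.
set t := real_complex R V0 ^- 2.
have nt : normc t = V0 ^- 2 by rewrite normcV normcX normc_real.
have t0 : t != 0.
  by rewrite invr_neq0 // expf_neq0 // (inj_eq (@complexI R)) gt_eqF.
have t4 : real_complex R V0 ^- 4 = t * t by rewrite -invfM -exprD.
have tV : V0 ^- 2 * V0 ^+ 2 = 1 by rewrite mulVf // gt_eqF.
pose q := normc t * mnorm Z * vnorm s.
have q0 : 0 <= q by rewrite !mulr_ge0 ?normc_ge0.
(* This is [hV] divided by [V0 ^+ 2]. *)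
have q1 : 4 * q < 1.
  have : V0 ^- 2 * (4 * mnorm Z * vnorm s) < V0 ^- 2 * V0 ^+ 2.
    by rewrite ltr_pM2l // invr_gt0.
  by rewrite tV /q nt; lra.
(* With radius 1/2 the general bounds become 2q for the image and 4q for the Lipschitz constant, so
   4q < 1 serves both. *)
have half1 : (2^-1 : R) < 1 by lra.
have fball (y : 'cV[R[i]]_n) : (forall k, normc (y k 0) <= 2^-1) ->
    forall h, normc (load_map Z s t y h 0) <= 2 * q.
  move=> hy h; apply: (le_trans (load_map_bound _ _ _ _ half1 hy)).
  by rewrite -/q le_eqVlt; apply/orP; left; apply/eqP; field.
have flip (y y' : 'cV[R[i]]_n) d : (forall k, normc (y k 0) <= 2^-1) ->
    (forall k, normc (y' k 0) <= 2^-1) ->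
    (forall k, normc ((y - y') k 0) <= d) ->
    forall h, normc ((load_map Z s t y - load_map Z s t y') h 0) <= 4 * q * d.
  move=> hy hy' hd h.
  apply: (le_trans (load_map_lipschitz _ _ _ _ half1 hy hy' hd)).
  by rewrite -/q le_eqVlt; apply/orP; left; apply/eqP; field.
have q01 : 0 <= 4 * q < 1 by apply/andP; split; lra.
have fball' (y : 'cV[R[i]]_n) : (forall k, normc (y k 0) <= 2^-1) ->
    forall h, normc (load_map Z s t y h 0) <= 2^-1.
  by move=> hy h; have := fball y hy h; lra.
have half0 : (0 : R) <= 2^-1 by lra.
have [y hy fy] := contraction_exists q01 half0 fball' flip.
exists ((real_complex R V0 * expj theta0) *: (const_mx 1 + y)); split.
  split.
    have y1 k : 1 + y k 0 != 0 := add1_neq0 half1 (hy k).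
    exact: (power_flow_solutionP Z theta0 s V00 y1).2 fy.
  (* This [lambda] solves [load_current s y = conjv s + t *: lambda], which turns the fixed-point
     equation into the displayed form. *)
  exists (t^-1 *: (load_current s y - conjv s)); split.
    rewrite t4 -addrA; congr (_ *: (_ + _)).
    rewrite -{1}fy /load_map -scalemxAr scalerA mulfK // -scalerDr -mulmxDr.
    by rewrite addrC subrK.
  (* One more application of the map sharpens 1/2 to 2q; this extra factor q makes the bound on
     [lambda] quadratic in the norm of [s]. *)
  have hy2 h : normc (y h 0) <= 2 * q by rewrite -fy; exact: fball.
  have h1 := load_current_sub s half1 hy hy2 ltac:(lra).
  have h2 : vnorm (t^-1 *: (load_current s y - conjv s)) <=
      V0 ^+ 2 * vnorm (load_current s y - conjv s).
    apply: ler_vnorm; first exact: ltW.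
    by move=> h; rewrite mxE normcM normcV nt invrK.
  apply: (le_trans h2).
  apply: (le_trans (ler_wpM2l (ltW V2) h1)).
  rewrite /q nt le_eqVlt; apply/orP; left; apply/eqP; field.
  by rewrite gt_eqF.
move=> v [hsol [lambda [hv hl]]]; move: hsol; rewrite hv t4 -addrA.
set y' : 'cV_n := t *: _ + _ => hsol.
(* The two corrections are at most q and 4q^2, and 4q < 1 bounds their sum by 2q < 1/2; uniqueness
   in the ball then applies. *)
have hy' h : normc (y' h 0) <= 2^-1.
  have hs : vnorm (conjv s) <= 1 * vnorm s.
    by apply: ler_vnorm => // k; rewrite mxE normc_conj mul1r.
  have h1 : normc ((t *: (Z *m conjv s)) h 0) <= q.
    rewrite mxE normcM /q -mulrA ler_wpM2l ?normc_ge0 //.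
    apply: (le_trans (normc_mulmx _ _ _)); rewrite ler_wpM2l //.
    by rewrite mul1r in hs.
  have h2 : normc ((t * t *: (Z *m lambda)) h 0) <= 4 * q ^+ 2.
    have -> : 4 * q ^+ 2 =
      normc (t * t) * (mnorm Z * (4 * mnorm Z * vnorm s ^+ 2)).
      by rewrite normcM /q; ring.
    rewrite mxE normcM ler_wpM2l ?normc_ge0 //.
    by apply: (le_trans (normc_mulmx _ _ _)); rewrite ler_wpM2l.
  rewrite mxE; apply: (le_trans (ler_normcD _ _)).
  apply: (le_trans (lerD h1 h2)).
  have q2 : 4 * q ^+ 2 <= q.
    by rewrite expr2 mulrA -[leRHS]mul1r ler_wpM2r // ltW.
  by move: (q) q1 q2; clear => p; lra.
congr (_ *: (_ + _)); apply: (contraction_unique q01 flip hy hy' fy).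
have y1 k : 1 + y' k 0 != 0 := add1_neq0 half1 (hy' k).
exact: (power_flow_solutionP Z theta0 s V00 y1).1 hsol.
Qed.
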